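(* Let $k\ge 1$ and consider the NEIM approximation with $k$ terms described in the context, with training weights satisfying $w_t^{(j)}(\mu_i)>0$ if and only if $\mu_i=\mu^{(j)}$, and error weights $w_e(\mu_i;\mu_j)=\delta_{ij}$. Let $\mathrm N(\mu):=U^\top \mathrm N(v(\mu);\mu)$, let $M^{(k)}$, $\widehat M^{(k)}$, $\theta^{(k)}$, $\widehat\theta^{(k)}$ be as defined in the context, and set $$\mathcal{E}_{\mathrm{NEIM}}^{(k)}:=\|\mathrm N-\widehat M^{(k)}\widehat\theta^{(k)}\|_{L^2(\mathcal{P})}.$$ Then $$\begin{aligned}\mathcal{E}_{\mathrm{NEIM}}^{(k)}\le{}&\|\mathrm N-M^{(k)}\theta^{(k)}\|_{L^2(\mathcal{P})}+\sum_{i=1}^k\|z^{(i)}(\mu^{(i)})-M_{\mu^{(i)}}(\tilde v(\cdot))\|_{L^2(\mathcal{P})}\,\|\theta_i^{(k)}\|_{L^\infty(\mathcal{P})}\\&+|\mathcal{P}|^{1/2}\sum_{i=1}^k\|\theta_i^{(k)}-\widehat\theta_i^{(k)}\|_{L^\infty(\mathcal{P})}+\sum_{i=1}^k\|M_{\mu^{(i)}}(\tilde v(\cdot))-z^{(i)}(\mu^{(i)})\|_{L^2(\mathcal{P})}\,\|\theta_i^{(k)}-\widehat\theta_i^{(k)}\|_{L^\infty(\mathcal{P})}.\end{aligned}$$ (The four terms are called, in order, the projection error, the training error contribution, the interpolation error contribution, and the training/interpolation interaction.)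
   Context: Setting. Let $p,n,r\in\mathbb{N}$ with $r\le n$, let $\mathcal{P}\subset\mathbb{R}^p$ be a compact parameter space with Lebesgue measure $|\mathcal{P}|$, and let $\mathrm N(\cdot;\mu):\mathbb{R}^n\to\mathbb{R}^n$, $\mu\in\mathcal{P}$, be a parameterized nonlinearity. Let $v(\mu)\in\mathbb{R}^n$ denote the high-fidelity solution of a discretized parameterized PDE $A(\mu)v+\mathrm N(v;\mu)=f(\mu)$, where $A(\mu)\in\mathbb{R}^{n\times n}$, $f(\mu)\in\mathbb{R}^n$. Let $U\in\mathbb{R}^{n\times r}$ be the matrix of the first $r$ left singular vectors (POD basis) of a snapshot matrix of solutions; its columns are orthonormal. Write $\tilde v(\mu)=U^\top v(\mu)\in\mathbb{R}^r$. Let $\mathcal{M}=\{\mu_1,\dots,\mu_m\}\subset\mathcal{P}$ be a finite set of (distinct) parameters, $v_i=v(\mu_i)$, $\tilde v_i=U^\top v_i$. The numbers $w_e(\mu_i;\mu)\in[0,\infty)$ (''error weights'') and $w_t^{(j)}(\mu_i)\in[0,\infty)$ (''training weights'') are given. $\|\cdot\|_2$ and $\langle\cdot,\cdot\rangle$ are the Euclidean norm and inner product; the $L^2(\mathcal{P})$ norm of an $\mathbb{R}^r$-valued function $g$ is $\big(\int_{\mathcal{P}}\|g(\mu)\|_2^2\,d\mu\big)^{1/2}$. All functions of $\mu$ appearing are assumed measurable with the norms that appear finite. NEIM (neural empirical interpolation method) training procedure. Set $\widehat{\mathrm N}^{(0)}\equiv 0$. At iteration $j=1,\dots,k$: 1.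 Choose $\mu^{(j)}\in\arg\max_{\mu\in\mathcal{M}\setminus\{\mu^{(1)},\dots,\mu^{(j-1)}\}}\sum_{i=1}^m w_e(\mu_i;\mu)\,\|U^\top \mathrm N(v_i;\mu)-\widehat{\mathrm N}^{(j-1)}(\tilde v_i;\mu)\|_2^2$. 2. For $i=1,\dots,m$ let $y^{(j)}(\mu_i)=U^\top \mathrm N(v_i;\mu^{(j)})$, and let $z^{(j)}(\mu_i)$ be obtained from it by Gram–Schmidt: start with $z=y^{(j)}(\mu_i)$; for $l=1,\dots,j-1$ replace $z$ by $z-\frac{\langle z,M_{\mu^{(l)}}(\tilde v_i)\rangle}{\|M_{\mu^{(l)}}(\tilde v_i)\|_2^2}M_{\mu^{(l)}}(\tilde v_i)$; finally put $z^{(j)}(\mu_i)=z/\|z\|_2$ (so $\|z^{(j)}(\mu_i)\|_2=1$). 3. Obtain a feedforward neural network $M_{\mu^{(j)}}:\mathbb{R}^r\to\mathbb{R}^r$ by training, i.e. by (numerically, not necessarily exactly) minimizing $\sum_{i=1}^m w_t^{(j)}(\mu_i)\|M_{\mu^{(j)}}(\tilde v_i)-z^{(j)}(\mu_i)\|_2^2$ over the network parameters. 4. For each $\mu\in\mathcal{M}$ choose coefficients $\theta_{1,\mathcal{M}}^{(j)}(\mu),\dots,\theta_{j,\mathcal{M}}^{(j)}(\mu)$ minimizing over $\theta\in\mathbb{R}^j$ the quantity $\sum_{i=1}^m w_e(\mu_i;\mu)\|U^\top \mathrm N(v_i;\mu)-\sum_{\ell=1}^j\theta_\ell M_{\mu^{(\ell)}}(\tilde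 v_i)\|_2^2$, and set $\widehat{\mathrm N}^{(j)}(\tilde v;\mu)=\sum_{\ell=1}^j\theta_{\ell,\mathcal{M}}^{(j)}(\mu)M_{\mu^{(\ell)}}(\tilde v)$. After the last iteration $k$, the coefficients are interpolated (or regressed) from $\mathcal{M}$ to all of $\mathcal{P}$; the resulting function is $\widehat\theta^{(k)}=(\widehat\theta_1^{(k)},\dots,\widehat\theta_k^{(k)}):\mathcal{P}\to\mathbb{R}^k$. Further definitions. $M^{(k)}\in\mathbb{R}^{r\times k}$ is the matrix with columns $z^{(1)}(\mu^{(1)}),\dots,z^{(k)}(\mu^{(k)})$ (constant in $\mu$). $\widehat M^{(k)}(\mu)\in\mathbb{R}^{r\times k}$ is the matrix with columns $M_{\mu^{(1)}}(\tilde v(\mu)),\dots,M_{\mu^{(k)}}(\tilde v(\mu))$. The exact coefficients are $\theta^{(k)}(\mu)=(\theta_1^{(k)}(\mu),\dots,\theta_k^{(k)}(\mu))\in\arg\min_{\theta\in\mathbb{R}^k}\|\mathrm N(\mu)-M^{(k)}\theta\|_2$ for $\mu\in\mathcal{P}$, where $\mathrm N(\mu)=U^\top \mathrm N(v(\mu);\mu)$. *)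

(* Defs.v *)
From HB Require Import structures.
From mathcomp Require Import all_boot all_order all_algebra.
From mathcomp Require Import all_classical all_reals all_analysis.

Set Implicit Arguments.
Unset Strict Implicit.
Unset Printing Implicit Defensive.

Import Order.TTheory GRing.Theory Num.Theory.
Import numFieldNormedType.Exports.

Local Open Scope classical_set_scope.
Local Open Scope ring_scope.

(* The Lebesgue measure on [R^p] is obtained by Caratheodory's construction
   from coverings by countably many half-open boxes.  A covering is a sequence
   with values in [option]; [None] stands for an unused index, so that finite
   coverings (in particular the empty one, which is needed when [p = 0]) are
   allowed. *)
Section lebesgue_outer.
Variables (R : realType) (p : nat).
Implicit Types (a b : 'rV[R]_p) (c : option ('rV[R]_p * 'rV[R]_p)).

Definition box a b : set 'rV[R]_p :=
  [set x | forall i, a 0 i < x 0 i <= b 0 i].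

Definition box_volume a b : R := \prod_(i < p) Num.max 0 (b 0 i - a 0 i).

Definition obox c : set 'rV[R]_p := if c is Some ab then box ab.1 ab.2 else set0.

Definition obox_volume c : \bar R :=
  (if c is Some ab then (box_volume ab.1 ab.2)%:E else 0)%E.

Definition box_cover (X : set 'rV[R]_p) :=
  [set B : nat -> option ('rV[R]_p * 'rV[R]_p) | X `<=` \bigcup_k obox (B k)].

Definition lebesgue_outer (X : set 'rV[R]_p) : \bar R :=
  ereal_inf [set (\sum_(k <oo) obox_volume (B k))%E | B in box_cover X].

Local Open Scope ereal_scope.

Lemma obox_volume_ge0 c : 0 <= obox_volume c.
Proof.
case: c => [ab|//]; rewrite lee_fin; apply: prodr_ge0 => i _.
by rewrite le_max lexx.
Qed.
#[local] Hint Resolve obox_volume_ge0 : core.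

Lemma lebesgue_outer_ge0 X : 0 <= lebesgue_outer X.
Proof. by apply: le_ereal_inf_tmp => _ [B _ <-]; exact: nneseries_ge0. Qed.

Lemma lebesgue_outer0 : lebesgue_outer set0 = 0.
Proof.
apply/eqP; rewrite eq_le lebesgue_outer_ge0 andbT.
apply: ereal_inf_lbound; exists (fun=> None); first by move=> x.
by rewrite eseries0.
Qed.

Lemma le_lebesgue_outer : {homo lebesgue_outer : X Y / X `<=` Y >-> X <= Y}.
Proof.
move=> X Y XY; apply/ereal_inf_le_tmp => _ [B YB <-].
by exists B => //; exact: subset_trans YB.
Qed.

Lemma lebesgue_outer_sigma_subadditive : sigma_subadditive lebesgue_outer.
Proof.
move=> X; have [[i ioo]|] := pselect (exists i, lebesgue_outer (X i) = +oo).
  rewrite (eseries_pinfty _ _ ioo) ?leey// => n _.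
  by rewrite -ltNye (lt_le_trans _ (lebesgue_outer_ge0 _)).
rewrite -forallNE => Xoo.
suff add2e (e : {posnum R}) : lebesgue_outer (\bigcup_n X n) <=
    \sum_(i <oo) lebesgue_outer (X i) + e%:num%:E.
  by apply/lee_addgt0Pr => _/posnumP[].
rewrite (le_trans _ (epsilon_trick _ _ _))//; last first.
  by move=> n; exact: lebesgue_outer_ge0.
pose Q n (B : nat -> option ('rV[R]_p * 'rV[R]_p)) := box_cover (X n) B /\
  \sum_(k <oo) obox_volume (B k) <=
  lebesgue_outer (X n) + (e%:num / (2 ^ n.+1)%:R)%:E.
have [G QG] : {G : nat -> nat -> option ('rV[R]_p * 'rV[R]_p)
    & forall n, Q n (G n)}.
  apply: (@choice _ _ Q) => n.
  have en1 : (0 < e%:num / (2 ^ n.+1)%:R)%R by [].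
  have : lebesgue_outer (X n) \is a fin_num.
    rewrite ge0_fin_numE ?lebesgue_outer_ge0// ltey; exact/eqP/Xoo.
  move=> /(lb_ereal_inf_adherent en1)[_ [B XB <-] muB].
  by exists B; split => //; exact/ltW.
pose w (ij : nat * nat) := obox_volume (G ij.1 ij.2).
have w_ge0 ij : 0 <= w ij by exact: obox_volume_ge0.
apply: (@le_trans _ _ (\esum_(ij in setT) w ij)).
  have /card_esym/ppcard_eqP[f] := card_nat2.
  apply: ereal_inf_lbound => /=.
  exists (fun k => G (f k).1 (f k).2).
    move=> x [i _ /(QG i).1[j _ Gx]]; exists (f^-1%FUN (i, j)) => //=.
    by rewrite invK ?inE.
  have -> : \sum_(k <oo) obox_volume (G (f k).1 (f k).2) =
      \sum_(k <oo) (w \o f) k by [].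
  rewrite nneseries_esumT; last by move=> k; exact: w_ge0.
  by rewrite -(reindex_esum setT setT f w).
rewrite (_ : esum _ _ = \sum_(i <oo) \sum_(j <oo) w (i, j)).
  apply: lee_nneseries => [n _|n _]; last exact: (QG n).2.
  by move=> _; exact: nneseries_ge0.
rewrite (_ : [set: nat * nat] = setT `*`` (fun=> setT)); last first.
  by apply/seteqP; split.
rewrite -(@esum_esum _ _ _ _ _ (fun i j => w (i, j)))//.
rewrite nneseries_esumT; last by move=> n; exact: nneseries_ge0.
by apply: eq_esum => i _; rewrite nneseries_esumT.
Qed.

HB.instance Definition _ := isOuterMeasure.Build R 'rV[R]_p lebesgue_outer
  lebesgue_outer0 lebesgue_outer_ge0 le_lebesgue_outer
  lebesgue_outer_sigma_subadditive.

End lebesgue_outer.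

(* The measurable sets of this copy of ['rV[R]_p] are the Lebesgue measurable
   (not only the Borel) sets. *)
Notation lebesgue_space R p := (caratheodory_type (@lebesgue_outer R p)).

Definition lebesgue_rV (R : realType) (p : nat) :
  set (lebesgue_space R p) -> \bar R := @lebesgue_outer R p.
HB.instance Definition _ (R : realType) (p : nat) :=
  isMeasure.Build _ (lebesgue_space R p) R (@lebesgue_rV R p)
    (@caratheodory_measure0 R 'rV[R]_p (@lebesgue_outer R p))
    (@caratheodory_measure_ge0 R 'rV[R]_p (@lebesgue_outer R p))
    (@caratheodory_measure_sigma_additive R 'rV[R]_p (@lebesgue_outer R p)).

Definition lebesgue_measurable_fun (R : realType) (p : nat) (D : set 'rV[R]_p)
    (g : 'rV[R]_p -> R) : Prop :=
  measurable_fun (D : set (lebesgue_space R p)) (g : lebesgue_space R p -> R).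

(* The [L^q] norm over [D] is the norm over [R^p] of the extension by zero. *)
Definition Lnorm_on (R : realType) (p : nat) (D : set 'rV[R]_p) (q : \bar R)
    (g : 'rV[R]_p -> R) : \bar R :=
  Lnorm (@lebesgue_rV R p) q ((EFin \o g) \_ D)%E.

(* The library norm on matrices is the maximum norm. *)
Definition dotcv (R : realType) (n : nat) (x y : 'cV[R]_n) : R :=
  \sum_(i < n) x i 0 * y i 0.

Definition norm2 (R : realType) (n : nat) (x : 'cV[R]_n) : R :=
  Num.sqrt (dotcv x x).

Definition L2norm (R : realType) (p n : nat) (D : set 'rV[R]_p)
    (g : 'rV[R]_p -> 'cV[R]_n) : \bar R :=
  Lnorm_on D 2%:E (fun mu => norm2 (g mu)).

Definition Linfnorm (R : realType) (p : nat) (D : set 'rV[R]_p)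
    (g : 'rV[R]_p -> R) : \bar R :=
  Lnorm_on D +oo%E g.

(* [S = W *m Sigma *m V^T] is a full singular value decomposition, with the
   singular values [sigma 0 >= sigma 1 >= ...] on the diagonal of the
   rectangular matrix [Sigma]. *)
Definition is_SVD (R : realType) (n s : nat) (S : 'M[R]_(n, s))
    (W : 'M[R]_n) (sigma : nat -> R) (V : 'M[R]_s) : Prop :=
  [/\ W^T *m W = 1%:M, V^T *m V = 1%:M,
      (forall i, 0 <= sigma i),
      (forall i j, (i <= j)%N -> sigma j <= sigma i)
    & S = W *m (\matrix_(i < n, j < s) (sigma i *+ (i == j :> nat))) *m V^T].

Definition is_POD_basis (R : realType) (n r s : nat) (hrn : (r <= n)%N)
    (S : 'M[R]_(n, s)) (U : 'M[R]_(n, r)) : Prop :=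
  exists W sigma V, is_SVD S W sigma V /\ U = colsub (widen_ord hrn) W.

(* An architecture fixes the layer widths and the (componentwise) activation
   function of every layer; the weights and biases are the parameters.  Taking
   [id] as last activation gives an affine output layer. *)
Inductive ffnn (R : realType) : nat -> nat -> Type :=
| OutputLayer (a b : nat) (act : R -> R) : ffnn R a b
| HiddenLayer (a h b : nat) (act : R -> R) (rest : ffnn R h b) : ffnn R a b.

Fixpoint ffnn_params (R : realType) (a b : nat) (N : ffnn R a b) : Type :=
  match N with
  | OutputLayer a b _ => ('M[R]_(b, a) * 'cV[R]_b)%type
  | HiddenLayer a h _ _ rest => ('M[R]_(h, a) * 'cV[R]_h * ffnn_params rest)%type
  end.

Fixpoint ffnn_eval (R : realType) (a b : nat) (N : ffnn R a b) :
    ffnn_params N -> 'cV[R]_a -> 'cV[R]_b :=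
  match N with
  | OutputLayer _ _ act => fun w x => map_mx act (w.1 *m x + w.2)
  | HiddenLayer _ _ _ act rest => fun w x =>
      ffnn_eval w.2 (map_mx act (w.1.1 *m x + w.1.2))
  end.

(* Parameters of the training set are referred to by their index in ['I_m].
   Iterations are numbered from [0]: iteration [j : 'I_k] is the [j+1]-st. *)
Record neim (R : realType) (p n r m k : nat) := Neim {
  nonlin : 'cV[R]_n -> 'rV[R]_p -> 'cV[R]_n;    (* N(. ; mu) *)
  hifi : 'rV[R]_p -> 'cV[R]_n;                  (* v(mu) *)
  pod : 'M[R]_(n, r);                           (* U *)
  train_pt : 'I_m -> 'rV[R]_p;                  (* mu_i *)
  w_err : 'I_m -> 'rV[R]_p -> R;                (* w_e(mu_i; mu) *)
  w_train : 'I_k -> 'I_m -> R;                  (* w_t^(j)(mu_i) *)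
  sel : 'I_k -> 'I_m;                           (* mu^(j) = train_pt (sel j) *)
  arch : 'I_k -> ffnn R r r;
  weights : forall j, ffnn_params (arch j);
  train_tol : 'I_k -> R;                        (* see [train_min] *)
  (* [coef j i l] is theta_{l, M}^(j)(mu_i), used for [l < j] only *)
  coef : nat -> 'I_m -> 'I_k -> R;
  (* interpolation or regression of vectors given at the training points *)
  interp : ('I_m -> 'cV[R]_k) -> 'rV[R]_p -> 'cV[R]_k
}.

Section neim_procedure.
Variables (R : realType) (p n r m k : nat) (D : neim R p n r m k).

Definition red_hifi (mu : 'rV[R]_p) : 'cV[R]_r := (pod D)^T *m hifi D mu.

(* U^T N(v_i; mu) *)
Definition snap_nonlin (i : 'I_m) (mu : 'rV[R]_p) : 'cV[R]_r :=
  (pod D)^T *m nonlin D (hifi D (train_pt D i)) mu.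

Definition red_nonlin (mu : 'rV[R]_p) : 'cV[R]_r :=
  (pod D)^T *m nonlin D (hifi D mu) mu.

Definition net (j : 'I_k) : 'cV[R]_r -> 'cV[R]_r := ffnn_eval (weights D j).

(* Nhat^(j)( . ; mu_i'), with [j] terms; it vanishes for [j = 0] *)
Definition neim_approx (j : nat) (i' : 'I_m) (x : 'cV[R]_r) : 'cV[R]_r :=
  \sum_(l < k | (l < j)%N) coef D j i' l *: net l x.

(* weighted squared error over the training set, for the parameter mu_i', of
   an approximation [g] of [U^T N(v_i; mu_i')] from [v~_i] *)
Definition neim_error (i' : 'I_m) (g : 'cV[R]_r -> 'cV[R]_r) : R :=
  \sum_(i < m) w_err D i (train_pt D i') *
    norm2 (snap_nonlin i (train_pt D i') - g (red_hifi (train_pt D i))) ^+ 2.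

Definition gs_step (z w : 'cV[R]_r) : 'cV[R]_r :=
  z - (dotcv z w / norm2 w ^+ 2) *: w.

Definition gs_residual (j : 'I_k) (i : 'I_m) : 'cV[R]_r :=
  foldl gs_step (snap_nonlin i (train_pt D (sel D j)))
    [seq net l (red_hifi (train_pt D i))
    | l <- [seq l : 'I_k <- enum 'I_k | (l < j)%N]].

(* z^(j)(mu_i) *)
Definition gs_target (j : 'I_k) (i : 'I_m) : 'cV[R]_r :=
  (norm2 (gs_residual j i))^-1 *: gs_residual j i.

Definition train_loss (j : 'I_k) (g : 'cV[R]_r -> 'cV[R]_r) : R :=
  \sum_(i < m) w_train D j i *
    norm2 (g (red_hifi (train_pt D i)) - gs_target j i) ^+ 2.

Definition available (j : 'I_k) (i : 'I_m) : Prop :=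
  forall l : 'I_k, (l < j)%N -> i <> sel D l.

Record neim_run : Prop := {
  sel_available : forall j, available j (sel D j);
  sel_max : forall (j : 'I_k) (i' : 'I_m), available j i' ->
    neim_error i' (neim_approx j i') <=
    neim_error (sel D j) (neim_approx j (sel D j));
  (* no division by zero occurs in the Gram-Schmidt procedure *)
  gs_divisor_neq0 : forall (j l : 'I_k) (i : 'I_m), (l < j)%N ->
    net l (red_hifi (train_pt D i)) != 0;
  gs_residual_neq0 : forall (j : 'I_k) (i : 'I_m), gs_residual j i != 0;
  (* Training is numerical: the loss is minimized over the network parameters
     up to a tolerance on which nothing is assumed. *)
  train_tol_ge0 : forall j, 0 <= train_tol D j;
  train_min : forall (j : 'I_k) (w : ffnn_params (arch D j)),
    train_loss j (net j) <= train_loss j (ffnn_eval w) + train_tol D j;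
  coef_min : forall (j : 'I_k) (i' : 'I_m) (t : 'I_k -> R),
    neim_error i' (neim_approx j.+1 i') <=
    neim_error i' (fun x => \sum_(l < k | (l < j.+1)%N) t l *: net l x)
}.

(* thetahat^(k) *)
Definition coef_hat : 'rV[R]_p -> 'cV[R]_k :=
  interp D (fun i => \col_l coef D k i l).

(* z^(j)(mu^(j)) *)
Definition mode (j : 'I_k) : 'cV[R]_r := gs_target j (sel D j).

(* M_{mu^(j)}(v~(mu)) *)
Definition net_mode (j : 'I_k) (mu : 'rV[R]_p) : 'cV[R]_r :=
  net j (red_hifi mu).

(* M^(k) *)
Definition mode_mx : 'M[R]_(r, k) := \matrix_(a, j) mode j a 0.

(* Mhat^(k)(mu) *)
Definition net_mx (mu : 'rV[R]_p) : 'M[R]_(r, k) :=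
  \matrix_(a, j) net_mode j mu a 0.

End neim_procedure.

(* Main.v *)
Require Import Defs.
From HB Require Import structures.
From mathcomp Require Import all_boot all_order all_algebra.
From mathcomp Require Import all_classical all_reals all_analysis.
From mathcomp Require Import measurable_realfun ess_sup_inf.
From mathcomp Require Import ring lra.

Set Implicit Arguments.
Unset Strict Implicit.
Unset Printing Implicit Defensive.

Import Order.TTheory GRing.Theory Num.Theory.
Import numFieldNormedType.Exports.

Local Open Scope classical_set_scope.
Local Open Scope ring_scope.

(** Pointwise, [N - Mhat thetahat] is the sum of [N - M theta],
    [\sum_j theta_j (z_j - m_j)], [\sum_j (theta_j - thetahat_j) z_j] and
    [\sum_j (theta_j - thetahat_j) (m_j - z_j)], where [z_j] and [m_j] are the
    columns of [M] and [Mhat]; Minkowski's inequality, [|z_j| = 1] and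
    [|a b|_2 <= |a|_oo |b|_2] give the bound.  Measurability of a function on [P]
    says something only when [P] itself is Lebesgue measurable.  A half-space
    splits every covering box into two boxes of the same total volume, so boxes
    satisfy Caratheodory's criterion; open sets are countable unions of rational
    boxes, and compact sets are closed. *)

(** * Euclidean norm of column vectors: Cauchy-Schwarz, triangle inequality, measurability *)

Section euclidean_norm.
Variables (R : realType) (n : nat).
Implicit Types (x y z : 'cV[R]_n) (a : R).

Lemma dotcvC x y : dotcv x y = dotcv y x.
Proof. by apply: eq_bigr => i _; rewrite mulrC. Qed.

Lemma dotcvDl x y z : dotcv (x + y) z = dotcv x z + dotcv y z.
Proof. by rewrite -big_split; apply: eq_bigr => i _; rewrite mxE mulrDl. Qed.

Lemma dotcvZl a x y : dotcv (a *: x) y = a * dotcv x y.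
Proof. by rewrite mulr_sumr; apply: eq_bigr => i _; rewrite mxE mulrA. Qed.

Lemma dotcv_ge0 x : 0 <= dotcv x x.
Proof. by apply: sumr_ge0 => i _; rewrite -expr2 sqr_ge0. Qed.

Lemma dotcv_eq0 x : (dotcv x x == 0) = (x == 0).
Proof.
apply/idP/eqP => [|->]; last by rewrite -(scale0r 0) dotcvZl mul0r.
rewrite psumr_eq0 => [/allP x0|i _]; last by rewrite -expr2 sqr_ge0.
apply/colP => i; rewrite mxE; apply/eqP.
by have := x0 i (mem_index_enum _); rewrite -expr2 sqrf_eq0.
Qed.

Lemma norm2_ge0 x : 0 <= norm2 x.
Proof. exact: sqrtr_ge0. Qed.

Lemma norm2_eq0 x : (norm2 x == 0) = (x == 0).
Proof. by rewrite sqrtr_eq0 le_eqVlt ltNge dotcv_ge0 orbF dotcv_eq0. Qed.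

Lemma sqr_norm2 x : norm2 x ^+ 2 = dotcv x x.
Proof. by rewrite sqr_sqrtr// dotcv_ge0. Qed.

Lemma norm2_0 : norm2 (0 : 'cV[R]_n) = 0.
Proof. by apply/eqP; rewrite norm2_eq0. Qed.

Lemma norm2Z a x : norm2 (a *: x) = `|a| * norm2 x.
Proof.
rewrite /norm2 dotcvZl dotcvC dotcvZl mulrA -expr2 sqrtrM ?sqr_ge0//.
by rewrite sqrtr_sqr.
Qed.

Lemma norm2_normalized x : x != 0 -> norm2 ((norm2 x)^-1 *: x) = 1.
Proof.
by move=> x0; rewrite norm2Z ger0_norm ?invr_ge0 ?norm2_ge0// mulVf// norm2_eq0.
Qed.

Lemma dotcv_le_norm2 x y : dotcv x y <= norm2 x * norm2 y.
Proof.
have [->|y0] := eqVneq y 0.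
  by rewrite dotcvC -(scale0r 0) dotcvZl mul0r mulr_ge0// norm2_ge0.
rewrite (le_trans (ler_norm _))// -ler_sqr ?nnegrE ?mulr_ge0 ?norm2_ge0//.
rewrite real_normK ?num_real// exprMn !sqr_norm2.
have yy0 : 0 < dotcv y y by rewrite lt_neqAle eq_sym dotcv_eq0 y0 dotcv_ge0.
(* The vector is <y,y> times the component of x orthogonal to y. With a, b, c as set below, its
   squared length is c (a c - b^2), and c > 0 gives b^2 <= a c. *)
have := dotcv_ge0 (dotcv y y *: x + (- dotcv x y) *: y).
rewrite dotcvDl !dotcvZl !(dotcvC _ (_ + _)) !dotcvDl !dotcvZl (dotcvC y x).
set a := dotcv x x; set b := dotcv x y; set c := dotcv y y in yy0 *.
rewrite (_ : _ + _ = c * (a * c - b ^+ 2)).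
  by rewrite pmulr_rge0// subr_ge0.
by ring.
Qed.

Lemma norm2D x y : norm2 (x + y) <= norm2 x + norm2 y.
Proof.
rewrite -ler_sqr ?nnegrE ?addr_ge0 ?norm2_ge0//.
rewrite sqr_norm2 dotcvDl !(dotcvC _ (_ + _)) !dotcvDl (dotcvC y x).
rewrite sqrrD !sqr_norm2; have := dotcv_le_norm2 x y; lra.
Qed.

Lemma norm2_sum I (s : seq I) (F : I -> 'cV[R]_n) :
  norm2 (\sum_(i <- s) F i) <= \sum_(i <- s) norm2 (F i).
Proof.
elim/big_rec2 : _ => [|i b a _ ba]; first by rewrite norm2_0.
by rewrite (le_trans (norm2D _ _))// lerD2l.
Qed.

(** The hypothesis is coordinatewise, so no sigma-algebra on vectors is involved: a sum of squares
    is measurable and the square root is continuous. *)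
Lemma measurable_norm2 d (T : measurableType d) (D : set T)
    (g : T -> 'cV[R]_n) :
  (forall i, measurable_fun D (fun t => g t i 0)) ->
  measurable_fun D (fun t => norm2 (g t)).
Proof.
move=> mg; apply: (measurableT_comp (f := @Num.sqrt R)).
  by apply: continuous_measurable_fun => t; exact: sqrt_continuous.
by apply: measurable_sum => a; exact: measurable_funM.
Qed.

Lemma mulmx_sum_col m (A : 'M[R]_(n, m)) (x : 'cV[R]_m) :
  A *m x = \sum_j x j 0 *: col j A.
Proof.
apply/colP => a; rewrite mxE summxE.
by apply: eq_bigr => j _; rewrite !mxE mulrC.
Qed.

End euclidean_norm.

(** * L^r norms on a measure space: monotonicity, homogeneity, bounded multipliers, finite sums,
    indicators *)

Section Lnorm_extra.
Context d {T : measurableType d} {R : realType}.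
Variable mu : {measure set T -> \bar R}.
Implicit Types (f g : T -> R) (r : R).
Local Open Scope ereal_scope.

(** Both t^r and t^(1/r) are nondecreasing on [0, +oo], which reduces the claim to monotonicity of
    the integral. *)
Lemma ae_le_Lnorm r f g : (0 < r)%R ->
  measurable_fun [set: T] f -> measurable_fun [set: T] g ->
  (\forall x \ae mu, `|f x| <= `|g x|)%R ->
  Lnorm mu r%:E (EFin \o f) <= Lnorm mu r%:E (EFin \o g).
Proof.
move=> r0 mf mg fg; rewrite unlock.
apply: gt0_ler_poweR; first by rewrite invr_ge0 ltW.
- by rewrite in_itv/= leey andbT integral_ge0// => x _; exact: poweR_ge0.
- by rewrite in_itv/= leey andbT integral_ge0// => x _; exact: poweR_ge0.
apply: ae_ge0_le_integral => //; do ?by move=> x _; exact: poweR_ge0.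
- apply: (measurableT_comp (measurable_poweR _)).
  by apply: measurableT_comp => //; apply: measurableT_comp.
- apply: (measurableT_comp (measurable_poweR _)).
  by apply: measurableT_comp => //; apply: measurableT_comp.
apply: filterS fg => x fgx _.
by apply: gt0_ler_poweR; rewrite ?in_itv/= ?lee_fin ?normr_ge0 ?leey// ltW.
Qed.

Lemma LnormZl r c g : (0 < r)%R -> measurable_fun [set: T] g ->
  Lnorm mu r%:E (EFin \o (fun x => c * g x)%R) =
  `|c|%:E * Lnorm mu r%:E (EFin \o g).
Proof.
move=> r0 mg; rewrite unlock.
under eq_integral => x _ do
  rewrite /= normrM powRM// EFinM.
rewrite ge0_integralZl//=; last first.
  apply/measurable_EFinP; apply: (measurableT_comp (measurable_powR _)).
  exact: measurableT_comp.
rewrite poweRM ?lee_fin ?powR_ge0//.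
  by rewrite poweR_EFin -powRrM mulfV ?gt_eqF// powRr1.
by rewrite integral_ge0// => x _; rewrite lee_fin powR_ge0.
Qed.

(* Where the whole space is null the library sets the [L^oo] norm to [0]. *)
Lemma ae_le_Lnormy f : Lnorm mu +oo (EFin \o f) < +oo ->
  (\forall x \ae mu, `|f x| <= fine (Lnorm mu +oo (EFin \o f)))%R.
Proof.
move=> foo; have [T0|T0] := eqVneq (mu [set: T]) 0.
  by exists [set: T]; split.
suff : \forall x \ae mu, (abse \o (EFin \o f)) x <= Lnorm mu +oo (EFin \o f).
  apply: filterS => x /=; rewrite -lee_fin fineK//.
  by rewrite ge0_fin_numE// Lnorm_ge0.
rewrite unlock lt0e T0 measure_ge0/=; exact: ess_sup_ge.
Qed.

(** Almost everywhere |f| is at most its L^oo norm c, so |f| |g| <= c |g|, and the constant c leaves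
    the norm by homogeneity. *)
Lemma Lnorm_mul_le r f g : (0 < r)%R ->
  measurable_fun [set: T] f -> measurable_fun [set: T] g ->
  Lnorm mu +oo (EFin \o f) < +oo ->
  Lnorm mu r%:E (EFin \o (fun x => `|f x| * g x)%R) <=
  Lnorm mu +oo (EFin \o f) * Lnorm mu r%:E (EFin \o g).
Proof.
move=> r0 mf mg foo; set c := Lnorm mu +oo _.
have c0 : 0 <= c by exact: Lnorm_ge0.
(* Finiteness turns c into a real scalar, in the form that [LnormZl] extracts. *)
have -> : c = `|fine c|%:E.
  by rewrite ger0_norm ?fine_ge0// fineK// ge0_fin_numE.
rewrite -LnormZl//; apply: ae_le_Lnorm => //.
- by apply: measurable_funM => //; exact: measurableT_comp.
- exact: measurable_funM.
apply: filterS (ae_le_Lnormy foo) => x fx.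
by rewrite !normrM normr_id ler_wpM2r// (le_trans fx)// ler_norm.
Qed.

Lemma Lnorm_sum_le I (s : seq I) (F : I -> T -> R) (q : \bar R) : 1 <= q ->
  (forall i, measurable_fun [set: T] (F i)) ->
  Lnorm mu q (EFin \o (fun x => \sum_(i <- s) F i x)%R) <=
  \sum_(i <- s) Lnorm mu q (EFin \o F i).
Proof.
move=> q1 mF; elim: s => [|i s ih].
  (* The empty sum is the zero function; its norm vanishes because q >= 1 excludes q = 0. *)
  rewrite big_nil (_ : EFin \o _ = cst 0); last first.
    by apply/funext => x /=; rewrite big_nil.
  by rewrite Lnorm0// gt_eqF// (lt_le_trans _ q1)// lte01.
rewrite big_cons (_ : (fun x => _) = (F i \+ (fun x => \sum_(i <- s) F i x))%R).
  rewrite (le_trans (eminkowski _ _ _ q1))//; first exact: measurable_sum.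
  by rewrite leeD2l.
by apply/funext => x /=; rewrite big_cons.
Qed.

(** The indicator equals its own r-th power, since 0^r = 0 for r > 0. This is the source of the
    factor |P|^(1/2). *)
Lemma Lnorm_indic r (A : set T) : measurable A -> (0 < r)%R ->
  Lnorm mu r%:E (EFin \o \1_A) = mu A `^ r^-1.
Proof.
move=> mA r0; rewrite unlock; congr (_ `^ _).
rewrite -[A in RHS]setIT -integral_indic//; apply: eq_integral => x _ /=.
rewrite indicE; case: (_ \in _); rewrite /= ?normr1 ?normr0 ?powR1//.
by rewrite powR0// gt_eqF.
Qed.

End Lnorm_extra.

(** * Lebesgue measurability of half-spaces, boxes, open sets and compact sets *)

Section lebesgue_closed.
Variables (R : realType) (p : nat).

(** Cutting a box along a hyperplane x_i = c moves one corner of each piece, in the coordinate i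
    only. *)
Definition set_coord (i : 'I_p) (v : 'rV[R]_p) (t : R) : 'rV[R]_p :=
  \row_j (if j == i then t else v 0 j).

(** The sides other than i are common factors. In direction i, with u^+ = max(0, u), what remains is
    (min(t,c) - s)^+ + (t - max(s,c))^+ = (t - s)^+; the truncation at 0 covers empty boxes and cuts
    that miss the box. *)
Lemma box_volume_split (a b : 'rV[R]_p) (i : 'I_p) (c : R) :
  box_volume a (set_coord i b (Num.min (b 0 i) c)) +
  box_volume (set_coord i a (Num.max (a 0 i) c)) b = box_volume a b.
Proof.
pose rest := \prod_(j < p | j != i) Num.max 0 (b 0 j - a 0 j).
rewrite /box_volume !(bigD1 (P := xpredT) i)//= !mxE eqxx -/rest.
under eq_bigr => j /negPf ji do rewrite mxE ji.
rewrite -/rest.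
under [X in _ + _ * X = _]eq_bigr => j /negPf ji do rewrite mxE ji.
rewrite -/rest -mulrDl; congr (_ * _).
move: (a 0 i) (b 0 i) => s t.
by case: (leP t c) => ?; case: (leP s c) => ?; do ![case: leP => ?]; lra.
Qed.

Lemma measurable_halfspace (i : 'I_p) (c : R) :
  measurable ([set x | x 0 i <= c] : set (lebesgue_space R p)).
Proof.
apply: le_caratheodory_measurable => X.
pose lo :=
  omap (fun ab : 'rV[R]_p * 'rV[R]_p =>
    (ab.1, set_coord i ab.2 (Num.min (ab.2 0 i) c))).
pose hi :=
  omap (fun ab : 'rV[R]_p * 'rV[R]_p =>
    (set_coord i ab.1 (Num.max (ab.1 0 i) c), ab.2)).
have vol o : (obox_volume (lo o) + obox_volume (hi o) = obox_volume o)%E.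
  by case: o => [[a b]|]; rewrite /= ?adde0// -EFinD box_volume_split.
apply: le_ereal_inf_tmp => _ [B XB <-].
apply: (@le_trans _ _ (\sum_(k <oo) obox_volume (lo (B k)) +
    \sum_(k <oo) obox_volume (hi (B k)))%E).
  apply: leeD; apply: ereal_inf_lbound.
    (* The half-open convention matches the cut: x_i <= c is absorbed by the closed upper end
       min(b_i, c), and x_i > c by the open lower end max(a_i, c). *)
    exists (lo \o B) => // x [/XB[k _ Bx] xc]; exists k => //.
    move: Bx; rewrite /= /lo; case: (B k) => [[a b]|]//= ab j.
    rewrite mxE; case: eqP => [->|_]; last exact: ab.
    by have /andP[-> xb] := ab i; rewrite le_min xb.
  exists (hi \o B) => // x [/XB[k _ Bx] /negP]; rewrite -ltNge => cx.
  exists k => //; move: Bx; rewrite /= /hi; case: (B k) => [[a b]|]//= ab j.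
  rewrite mxE; case: eqP => [->|_]; last exact: ab.
  by have /andP[ax ->] := ab i; rewrite gt_max ax cx.
rewrite -nneseriesD//; do ?by move=> *; exact: obox_volume_ge0.
by under eq_eseriesr do rewrite vol.
Qed.

Lemma measurable_box (a b : 'rV[R]_p) :
  measurable (box a b : set (lebesgue_space R p)).
Proof.
rewrite (_ : box a b = \bigcap_(i in [set: 'I_p])
    ([set x | x 0 i <= b 0 i] `&` ~` [set x | x 0 i <= a 0 i])).
  apply: fin_bigcap_measurable => [|i _]; first exact: finite_finset.
  apply: measurableI.
    exact: measurable_halfspace.
  by apply: measurableC; exact: measurable_halfspace.
apply/seteqP; split => [x xab i _|x xab i].
  by have /andP[ax xb] := xab i; split => //; apply/negP; rewrite -ltNge.
by have [/= -> /negP] := xab i Logic.I; rewrite -ltNge => ->.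
Qed.

(** Rational corners make the family of boxes countable. *)
Lemma open_bigcup_box (A : set 'rV[R]_p) : open A ->
  A = \bigcup_(ab in [set ab : 'rV[rat]_p * 'rV[rat]_p |
    box (map_mx ratr ab.1) (map_mx ratr ab.2) `<=` A])
    box (map_mx ratr ab.1) (map_mx ratr ab.2).
Proof.
move=> oA; apply/seteqP; split => [x Ax|x [ab abA]]; last exact: abA.
have /nbhs_ballP[e /= e0 xeA] : nbhs x A by exact: open_nbhs_nbhs.
have lor i : exists q : rat, x 0 i - e < ratr q < x 0 i.
  by apply: rat_in_itvoo; rewrite ltrBlDr ltrDl.
have hir i : exists q : rat, x 0 i < ratr q < x 0 i + e.
  by apply: rat_in_itvoo; rewrite ltrDl.
have [a xa] := choice lor; have [b xb] := choice hir.
(* The corners satisfy x_i - e < a_i < x_i < b_i < x_i + e, so the box contains x and lies in its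
   e-ball, balls being those of the maximum norm. *)
exists (\row_i a i, \row_i b i) => /= [y yab|i].
  apply: xeA; split=> // i j; rewrite ord1 /ball/=.
  have := yab j; rewrite !mxE => /andP[ay yb].
  have /andP[? _] := xa j; have /andP[_ ?] := xb j.
  by rewrite ltr_distlC; apply/andP; split; lra.
rewrite !mxE; have /andP[_ ->] := xa i.
by have /andP[/ltW ->] := xb i.
Qed.

Lemma open_lebesgue_measurable (A : set 'rV[R]_p) : open A ->
  measurable (A : set (lebesgue_space R p)).
Proof.
(* The union is taken over all pairs of rational vectors, a countable type; pairs whose box is not
   inside A contribute the empty set. *)
move=> /open_bigcup_box ->; rewrite bigcup_mkcond.
apply: countable_bigcupT_measurable => // ab.
by case: ifP => // _; exact: measurable_box.
Qed.

Lemma compact_lebesgue_measurable (A : set 'rV[R]_p) : compact A ->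
  measurable (A : set (lebesgue_space R p)).
Proof.
move=> /(compact_closed (@norm_hausdorff _ _)) cA.
rewrite -(setCK A); apply: measurableC.
by apply: open_lebesgue_measurable; exact: closed_openC.
Qed.

End lebesgue_closed.

(** * Transfer of the norm estimates to P through extension by zero *)

Section Lnorm_on_extra.
Variables (R : realType) (p : nat) (P : set 'rV[R]_p).
Hypothesis mP : measurable (P : set (lebesgue_space R p)).
Implicit Types (f g : 'rV[R]_p -> R) (q : \bar R) (r : R).
Local Notation lmeasurable g := (lebesgue_measurable_fun P g).

Lemma patch0E g mu : (g \_ P) mu = if mu \in P then g mu else 0.
Proof. reflexivity. Qed.

Lemma Lnorm_on_patch q g :
  Lnorm_on P q g = Lnorm (@lebesgue_rV R p) q (EFin \o (g \_ P)).
Proof.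
by rewrite /Lnorm_on restrict_EFin.
Qed.

Lemma lebesgue_measurable_patch g :
  lmeasurable g -> measurable_fun [set: lebesgue_space R p] (g \_ P).
Proof.
move=> mg.
exact: (proj1 (measurable_restrictT (g : lebesgue_space R p -> R) mP) mg).
Qed.

Lemma le_Lnorm_on r f g : 0 < r -> lmeasurable f -> lmeasurable g ->
  (forall mu, P mu -> `|f mu| <= `|g mu|) ->
  (Lnorm_on P r%:E f <= Lnorm_on P r%:E g)%E.
Proof.
move=> r0 mf mg fg; rewrite !Lnorm_on_patch.
apply: ae_le_Lnorm; [exact: r0|exact: lebesgue_measurable_patch..|].
apply: nearW => mu; rewrite !patch0E; case: ifPn => // /set_mem; exact: fg.
Qed.

Lemma Lnorm_onD q f g : (1 <= q)%E -> lmeasurable f -> lmeasurable g ->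
  (Lnorm_on P q (fun mu => f mu + g mu)%R <= Lnorm_on P q f + Lnorm_on P q g)%E.
Proof.
move=> q1 mf mg; rewrite !Lnorm_on_patch.
rewrite (_ : EFin \o _ = EFin \o (f \_ P \+ g \_ P)).
  by apply: eminkowski; [exact: lebesgue_measurable_patch..|exact: q1].
by apply/funext => mu /=; rewrite !patch0E; case: ifPn => // _; rewrite addr0.
Qed.

Lemma Lnorm_on_sum q I (s : seq I) (F : I -> 'rV[R]_p -> R) : (1 <= q)%E ->
  (forall i, lmeasurable (F i)) ->
  (Lnorm_on P q (fun mu => \sum_(i <- s) F i mu)%R <=
   \sum_(i <- s) Lnorm_on P q (F i))%E.
Proof.
move=> q1 mF; rewrite !Lnorm_on_patch.
under eq_bigr do rewrite Lnorm_on_patch.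
rewrite (_ : EFin \o _ = EFin \o (fun mu => \sum_(i <- s) (F i \_ P) mu)).
  apply: (@Lnorm_sum_le _ (lebesgue_space R p)); [exact: q1|move=> i].
  exact: lebesgue_measurable_patch.
(* Extension by zero commutes with finite sums: off P every term is 0. *)
apply/funext => mu /=; rewrite patch0E; congr EFin; case: ifPn => muP.
  by apply: eq_bigr => i _; rewrite patch0E muP.
by rewrite big1// => i _; rewrite patch0E (negPf muP).
Qed.

Lemma Lnorm_on_mul r f g : 0 < r -> lmeasurable f -> lmeasurable g ->
  (Linfnorm P f < +oo)%E ->
  (Lnorm_on P r%:E (fun mu => `|f mu| * g mu)%R <=
   Linfnorm P f * Lnorm_on P r%:E g)%E.
Proof.
move=> r0 mf mg; rewrite /Linfnorm !Lnorm_on_patch => foo.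
rewrite (_ : EFin \o _ = EFin \o (fun mu => `|(f \_ P) mu| * (g \_ P) mu)).
  by apply: Lnorm_mul_le; [exact: r0|exact: lebesgue_measurable_patch..|exact: foo].
apply/funext => mu /=; rewrite !patch0E; case: ifPn => // _.
by rewrite mulr0.
Qed.

Lemma Lnorm_on1 r : 0 < r ->
  Lnorm_on P r%:E (cst 1) = (lebesgue_rV P `^ r^-1)%E.
Proof.
move=> r0; rewrite Lnorm_on_patch -Lnorm_indic//; congr (Lnorm _ _ (EFin \o _)).
by apply/funext => mu; rewrite patch0E indicE; case: ifPn.
Qed.

End Lnorm_on_extra.

(** * The pointwise four-term bound *)

(** Columnwise, t z - u m = t (z - m) + (t - u) z + (t - u) (m - z). The factor 1 stands for the
    length of z and gives the three sums a common shape. *)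
Lemma norm2_mulmx_perturb (R : realType) (r k : nat) (v : 'cV[R]_r)
    (Z M : 'M[R]_(r, k)) (t u : 'cV[R]_k) :
  (forall j, norm2 (col j Z) = 1) ->
  norm2 (v - M *m u) <=
  norm2 (v - Z *m t)
  + \sum_(j < k) `|t j 0| * norm2 (col j Z - col j M)
  + \sum_(j < k) `|t j 0 - u j 0| * 1
  + \sum_(j < k) `|t j 0 - u j 0| * norm2 (col j M - col j Z).
Proof.
move=> Z1; have -> : v - M *m u = v - Z *m t
    + \sum_(j < k) t j 0 *: (col j Z - col j M)
    + \sum_(j < k) (t j 0 - u j 0) *: col j Z
    + \sum_(j < k) (t j 0 - u j 0) *: (col j M - col j Z).
  rewrite !mulmx_sum_col -!addrA; congr (v + _).
  rewrite -!sumrN -!big_split; apply: eq_bigr => j _ /=.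
  by apply/colP => a; rewrite !mxE; ring.
have step (w : 'cV[R]_r) (c : R) (a : 'I_k -> R) (y : 'I_k -> 'cV[R]_r) :
    norm2 w <= c -> norm2 (w + \sum_j a j *: y j) <=
    c + \sum_j `|a j| * norm2 (y j).
  move=> wc; rewrite (le_trans (norm2D _ _))// lerD//.
  rewrite (le_trans (norm2_sum _ _))//.
  by apply: ler_sum => j _; rewrite norm2Z.
(* Each use of [step] peels off the last sum; the factor 1 is first turned back into the norm of a
   column of Z. *)
apply: (step); under [X in _ <= _ + X]eq_bigr => j _ do rewrite -(Z1 j).
by do 2!apply: (step).
Qed.

(** * Columns of the two mode matrices and the unit length of the modes *)

Section neim_modes.
Variables (R : realType) (p n r m k : nat) (D : neim R p n r m k).

Lemma col_mode_mx j : col j (mode_mx D) = mode D j.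
Proof. by apply/colP => a; rewrite !mxE. Qed.

Lemma col_net_mx j mu : col j (net_mx D mu) = net_mode D j mu.
Proof. by apply/colP => a; rewrite !mxE. Qed.

(** A mode is a normalized Gram-Schmidt residual, which is nonzero in any run of the procedure. *)
Lemma norm2_mode j : neim_run D -> norm2 (mode D j) = 1.
Proof. by move=> run; apply: norm2_normalized; exact: gs_residual_neq0. Qed.

End neim_modes.

(** * Passage from the pointwise bound to norms over P *)

Theorem mainTheorem2 (R : realType) (p n r m k s : nat)
  (hrn : (r <= n)%N) (hk : (1 <= k)%N)
  (P : set 'rV[R]_p) (P_compact : compact P)
  (D : neim R p n r m k)
  (A : 'rV[R]_p -> 'M[R]_n) (f : 'rV[R]_p -> 'cV[R]_n)
  (hifi_sol : forall mu, P mu ->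
    A mu *m hifi D mu + nonlin D (hifi D mu) mu = f mu)
  (snap : 'I_s -> 'rV[R]_p) (snapP : forall j, P (snap j))
  (U_POD : is_POD_basis hrn (\matrix_(a, j) hifi D (snap j) a 0) (pod D))
  (train_pt_inj : injective (train_pt D))
  (train_ptP : forall i, P (train_pt D i))
  (w_err_ge0 : forall i mu, P mu -> 0 <= w_err D i mu)
  (w_train_ge0 : forall j i, 0 <= w_train D j i)
  (w_train_pos : forall j i,
    0 < w_train D j i <-> train_pt D i = train_pt D (sel D j))
  (w_err_delta : forall i j, w_err D i (train_pt D j) = (i == j)%:R)
  (run : neim_run D)
  (theta : 'rV[R]_p -> 'cV[R]_k)
  (theta_min : forall mu, P mu -> forall t : 'cV[R]_k,
    norm2 (red_nonlin D mu - mode_mx D *m theta mu) <=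
    norm2 (red_nonlin D mu - mode_mx D *m t))
  (red_nonlin_meas : forall a,
    lebesgue_measurable_fun P (fun mu => red_nonlin D mu a 0))
  (net_mode_meas : forall j a,
    lebesgue_measurable_fun P (fun mu => net_mode D j mu a 0))
  (theta_meas : forall j,
    lebesgue_measurable_fun P (fun mu => theta mu j 0))
  (coef_hat_meas : forall j,
    lebesgue_measurable_fun P (fun mu => coef_hat D mu j 0))
  (proj_fin :
    (L2norm P (fun mu => red_nonlin D mu - mode_mx D *m theta mu)%R < +oo)%E)
  (train_fin : forall j,
    (L2norm P (fun mu => mode D j - net_mode D j mu)%R < +oo)%E)
  (theta_fin : forall j, (Linfnorm P (fun mu => theta mu j 0)%R < +oo)%E)
  (interp_fin : forall j,
    (Linfnorm P (fun mu => theta mu j 0 - coef_hat D mu j 0)%R < +oo)%E) :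
  (L2norm P (fun mu => red_nonlin D mu - net_mx D mu *m coef_hat D mu)%R <=
     L2norm P (fun mu => red_nonlin D mu - mode_mx D *m theta mu)%R
   + \sum_(j < k) L2norm P (fun mu => mode D j - net_mode D j mu)%R
                  * Linfnorm P (fun mu => theta mu j 0)%R
   + lebesgue_rV P `^ 2^-1
     * (\sum_(j < k) Linfnorm P (fun mu => theta mu j 0 - coef_hat D mu j 0)%R)
   + \sum_(j < k) L2norm P (fun mu => net_mode D j mu - mode D j)%R
                  * Linfnorm P (fun mu => theta mu j 0 - coef_hat D mu j 0)%R)%E.
Proof.
have mP := compact_lebesgue_measurable P_compact.
(* [F0] to [F3] are the four terms of the pointwise bound; the constant 1 in [F2] lets it be treated
   like [F1] and [F3]. *)
pose F0 mu := norm2 (red_nonlin D mu - mode_mx D *m theta mu).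
pose dtheta (j : 'I_k) mu := theta mu j 0 - coef_hat D mu j 0.
pose F1 j mu := `|theta mu j 0| * norm2 (mode D j - net_mode D j mu).
pose F2 j mu := `|dtheta j mu| * cst (1 : R) mu.
pose F3 j mu := `|dtheta j mu| * norm2 (net_mode D j mu - mode D j).
have mdtheta j : lebesgue_measurable_fun P (dtheta j).
  by apply: measurable_funB; [exact: theta_meas|exact: coef_hat_meas].
have mZM j : lebesgue_measurable_fun P
    (fun mu => norm2 (mode D j - net_mode D j mu)).
  apply: measurable_norm2 => a; under eq_fun do rewrite mxE [in X in _ + X]mxE.
  by apply: measurable_funB; [exact: measurable_cst|exact: net_mode_meas].
have mMZ j : lebesgue_measurable_fun P
    (fun mu => norm2 (net_mode D j mu - mode D j)).
  apply: measurable_norm2 => a; under eq_fun do rewrite mxE [in X in _ + X]mxE.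
  by apply: measurable_funB; [exact: net_mode_meas|exact: measurable_cst].
have m1 : lebesgue_measurable_fun P (cst 1) by exact: measurable_cst.
have mF0 : lebesgue_measurable_fun P F0.
  apply: measurable_norm2 => a.
  under eq_fun do rewrite mxE [in X in _ + X]mxE [in X in _ - X]mxE.
  apply: measurable_funB; first exact: red_nonlin_meas.
  apply: measurable_sum => j.
  by apply: measurable_funM; [exact: measurable_cst|exact: theta_meas].
have mmul (b g : 'rV[R]_p -> R) : lebesgue_measurable_fun P b ->
    lebesgue_measurable_fun P g ->
    lebesgue_measurable_fun P (fun mu => `|b mu| * g mu).
  by move=> mb mg; apply: measurable_funM; [exact: measurableT_comp|exact: mg].
have mF1 j : lebesgue_measurable_fun P (F1 j) by exact: mmul.
have mF2 j : lebesgue_measurable_fun P (F2 j) by exact: mmul.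
have mF3 j : lebesgue_measurable_fun P (F3 j) by exact: mmul.
have msum (F : 'I_k -> 'rV[R]_p -> R) :
    (forall j, lebesgue_measurable_fun P (F j)) ->
    lebesgue_measurable_fun P (fun mu => \sum_(j < k) F j mu).
  by move=> mF; exact: measurable_sum.
have madd (b g : 'rV[R]_p -> R) : lebesgue_measurable_fun P b ->
    lebesgue_measurable_fun P g ->
    lebesgue_measurable_fun P (fun mu => b mu + g mu).
  by move=> mb mg; exact: measurable_funD.
have mF01 := madd _ _ mF0 (msum _ mF1).
have mF012 := madd _ _ mF01 (msum _ mF2).
have mF0123 := madd _ _ mF012 (msum _ mF3).
have two0 : 0 < 2 :> R by [].
have two1 : (1 <= 2%:E :> \bar R)%E by rewrite lee_fin ler1n.
apply: (@le_trans _ _ (Lnorm_on P 2%:E (fun mu => F0 mu + \sum_(j < k) F1 j mu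
    + \sum_(j < k) F2 j mu + \sum_(j < k) F3 j mu))).
  apply: (le_Lnorm_on mP two0 _ mF0123) => [|mu Pmu]; last first.
  - rewrite ger0_norm ?norm2_ge0// (le_trans _ (ler_norm _))//.
    have := @norm2_mulmx_perturb _ _ _ (red_nonlin D mu) (mode_mx D)
      (net_mx D mu) (theta mu) (coef_hat D mu).
    under [X in _ + X + _ + _]eq_bigr => j _ do rewrite col_mode_mx col_net_mx.
    under [X in _ + _ + _ + X]eq_bigr => j _ do rewrite col_mode_mx col_net_mx.
    by apply => j; rewrite col_mode_mx norm2_mode.
  - apply: measurable_norm2 => a.
    under eq_fun do rewrite mxE [in X in _ + X]mxE [in X in _ - X]mxE.
    apply: measurable_funB; first exact: red_nonlin_meas.
    apply: measurable_sum => j; apply: measurable_funM.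
      by under eq_fun do rewrite mxE; exact: net_mode_meas.
    exact: coef_hat_meas.
(* |P|^(1/2) is moved inside its sum, so that all three sums have the form required by [bound]. *)
rewrite ge0_sume_distrr; last by move=> j _; exact: Lnorm_ge0.
(* Minkowski over j, then the L^oo bound on each multiplier. The value c_j is left free: an L^2
   error for [F1] and [F3], |P|^(1/2) for [F2]. *)
have bound (a g : 'I_k -> 'rV[R]_p -> R) (c : 'I_k -> \bar R) :
    (forall j, lebesgue_measurable_fun P (a j)) ->
    (forall j, lebesgue_measurable_fun P (g j)) ->
    (forall j, (Linfnorm P (a j) < +oo)%E) ->
    (forall j, Lnorm_on P 2%:E (g j) = c j) ->
    (Lnorm_on P 2%:E (fun mu => \sum_(j < k) `|a j mu| * g j mu)%R <=
     \sum_(j < k) c j * Linfnorm P (a j))%E.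
  move=> ma mg aoo gc; apply: le_trans.
    by apply: Lnorm_on_sum => // j; exact: mmul.
  by apply: lee_sum => j _; rewrite muleC -gc; exact: Lnorm_on_mul.
(* Minkowski splits off the interaction, interpolation and training sums, in this order. *)
have F3le := Lnorm_onD mP two1 mF012 (msum _ mF3).
have F2le := Lnorm_onD mP two1 mF01 (msum _ mF2).
have F1le := Lnorm_onD mP two1 mF0 (msum _ mF1).
apply: (le_trans F3le); apply: leeD; last exact: bound.
apply: (le_trans F2le); apply: leeD.
  by apply: (le_trans F1le); apply: leeD; [exact: lexx|exact: bound].
by apply: bound => // j; exact: Lnorm_on1.
Qed.
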